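(* For any connected graph $G$ of order $n\ge 2$, $EC(G)=\frac{n(n-1)}{2}$ if and only if $G$ is (isomorphic to) one of the complete graphs in the set $\{K_2,K_3,K_4,K_5\}$.
   Context: Graphs are finite and simple; the order is the number of vertices. Two distinct edges are adjacent if they share an endpoint. A set $D\subseteq E$ is an edge-dominating set of $G=(V,E)$ if every edge in $E\setminus D$ is adjacent to an edge of $D$. Two disjoint sets of edges $E_1,E_2$ form an edge coalition if neither is an edge-dominating set but $E_1\cup E_2$ is. An $ec$-partition of $G$ is a partition $\pi=\{E_1,\ldots,E_k\}$ of $E$ into nonempty sets such that every $E_i$ is either a singleton edge-dominating set, or is not an edge-dominating set but forms an edge coalition with another set $E_j$ of $\pi$. The edge coalition number $EC(G)$ is the maximum order $k$ of an $ec$-partition of $G$. *)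

(* Defs.v *)
From mathcomp Require Import all_boot.
Set Implicit Arguments.
Unset Strict Implicit.
Unset Printing Implicit Defensive.

Record sgraph := SGraph {
  vertex :> finType;
  adj : rel vertex;
  adj_sym : symmetric adj;
  adj_irr : irreflexive adj
}.

Definition connected_graph (G : sgraph) : Prop :=
  forall x y : G, connect (@adj G) x y.

Definition isomorphic (G H : sgraph) : Prop :=
  exists2 f : G -> H, bijective f & forall x y : G, adj (f x) (f y) = adj x y.

Definition complete_adj (n : nat) : rel 'I_n := fun i j => i != j.

Lemma complete_adj_sym n : symmetric (@complete_adj n).
Proof. by move=> i j; rewrite /complete_adj eq_sym. Qed.

Lemma complete_adj_irr n : irreflexive (@complete_adj n).
Proof. by move=> i; rewrite /complete_adj eqxx. Qed.

Definition complete_graph (n : nat) : sgraph :=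
  SGraph (@complete_adj_sym n) (@complete_adj_irr n).

Section EdgeCoalition.
Variable G : sgraph.

(* An edge is the two-element set of its endpoints. *)
Definition edges : {set {set G}} :=
  [set a | [exists x : G, exists y : G, adj x y && (a == [set x; y])]].

Definition edge_adj : rel {set G} :=
  fun e f => (e != f) && (e :&: f != set0).

Definition edge_dominating (D : {set {set G}}) : bool :=
  (D \subset edges) &&
  [forall e in edges :\: D, [exists f in D, edge_adj e f]].

Definition edge_coalition (A B : {set {set G}}) : bool :=
  [&& A \subset edges, B \subset edges, [disjoint A & B],
      ~~ edge_dominating A, ~~ edge_dominating B & edge_dominating (A :|: B)].

(* [partition] already requires the blocks to be nonempty. *)
Definition ec_partition (P : {set {set {set G}}}) : bool :=
  partition P edges &&
  [forall A in P,
     ((#|A| == 1) && edge_dominating A) ||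
     (~~ edge_dominating A && [exists B in P :\ A, edge_coalition A B])].

(* The value is 0 if G has no ec-partition. *)
Definition EC : nat :=
  \max_(P : {set {set {set G}}} | ec_partition P) #|P|.

End EdgeCoalition.

(* Main.v *)
Require Import Defs.
From mathcomp Require Import all_boot.
Set Implicit Arguments.
Unset Strict Implicit.
Unset Printing Implicit Defensive.

(** A partition of the edge set into nonempty blocks has at most as many blocks
    as there are edges, and a graph of order [n] has at most ['C(n, 2)] edges;
    so the order of an ec-partition can reach [n(n-1)/2] only if [G] is
    complete and all blocks are singletons ([partition_card_singletons]).  Then
    a block, alone or together with its partner, is an edge-dominating set of
    at most two edges.  A set of edges dominates exactly when its endpoints
    form a vertex cover ([edge_dominatingP]), which in a complete graph means
    that it misses at most one vertex ([complete_dominating]).  Two edges have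
    at most four endpoints, whence [n <= 5].

    Conversely, let [G] be complete with [2 <= n <= 5] and split its edge set
    into singletons.  For [n <= 3] one edge misses at most one vertex, so every
    block is dominating.  For [n = 4, 5] one edge misses at least two vertices,
    so it does not dominate, but any edge disjoint from it is a coalition
    partner: the two edges have four endpoints and miss at most one vertex. *)

Definition complete (G : sgraph) : Prop :=
  forall x y : G, adj x y = (x != y).

Lemma isomorphic_completeP (G : sgraph) (k : nat) :
  isomorphic G (complete_graph k) <-> complete G /\ #|G| = k.
Proof.
split=> [[f bij_f f_adj] | [Gc cardG]].
  split=> [x y|]; last by rewrite (bij_eq_card bij_f) card_ord.
  by rewrite -f_adj /= /complete_adj (inj_eq (bij_inj bij_f)).
case: k / cardG; exists (fun x : G => enum_rank x : complete_graph #|G|).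
  exact: enum_rank_bij.
by move=> x y; rewrite Gc /= /complete_adj (inj_eq enum_rank_inj).
Qed.

Section Edges.
Variable G : sgraph.
Implicit Types (D : {set {set G}}) (e : {set G}) (x y : G).

Lemma edgesP e :
  reflect (exists x y, adj x y /\ e = [set x; y]) (e \in edges G).
Proof.
rewrite inE; apply: (iffP existsP) => [[x /existsP[y /andP[xy /eqP->]]]|].
  by exists x, y.
by case=> x [y [xy ->]]; exists x; apply/existsP; exists y; rewrite xy eqxx.
Qed.

Lemma card_edge e : e \in edges G -> #|e| = 2.
Proof.
case/edgesP=> x [y [xy ->]]; rewrite cards2.
by case: eqP xy => // ->; rewrite adj_irr.
Qed.

Lemma edges_sub_pairs : edges G \subset [set e : {set G} | #|e| == 2].
Proof. by apply/subsetP=> e eG; rewrite inE card_edge. Qed.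

Lemma card_edges_le : #|edges G| <= 'C(#|G|, 2).
Proof. by rewrite -card_draws subset_leq_card ?edges_sub_pairs. Qed.

Lemma edges_complete :
  complete G -> edges G = [set e : {set G} | #|e| == 2].
Proof.
move=> Gc; apply/eqP; rewrite eqEsubset edges_sub_pairs /=.
apply/subsetP=> e pair_e; have /cards2P[x [y [xy ->]]] : #|e| == 2.
  by rewrite inE in pair_e.
by apply/edgesP; exists x, y; rewrite Gc.
Qed.

Lemma card_edges_complete : complete G -> #|edges G| = 'C(#|G|, 2).
Proof. by move/edges_complete->; rewrite card_draws. Qed.

Lemma complete_of_card_edges : 'C(#|G|, 2) <= #|edges G| -> complete G.
Proof.
rewrite -card_draws => le_edges x y.
have [->|xy] := eqVneq x y; first by rewrite adj_irr.
have /eqP eqE : edges G == [set e : {set G} | #|e| == 2].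
  by rewrite eqEcard edges_sub_pairs.
have /edgesP[u [v [uv eq_xy]]] : [set x; y] \in edges G.
  by rewrite eqE inE cards2 xy.
have: x \in [set u; v] by rewrite -eq_xy set21.
have: y \in [set u; v] by rewrite -eq_xy set22.
rewrite !inE => /orP[]/eqP ey /orP[]/eqP ex; subst=> //.
- by rewrite eqxx in xy.
- by rewrite adj_sym.
- by rewrite eqxx in xy.
Qed.

(** An edge outside [D] that meets an edge of [D] is adjacent to it, so being
    dominated just means having an endpoint covered by [D]. *)
Lemma edge_dominatingP D : D \subset edges G ->
  reflect (forall x y, adj x y -> (x \in cover D) || (y \in cover D))
          (edge_dominating D).
Proof.
move=> DE; rewrite /edge_dominating DE /=; apply: (iffP forall_inP).
  move=> domD x y xy.
  have [xyD|xyD] := boolP ([set x; y] \in D).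
    by apply/orP; left; apply/bigcupP; exists [set x; y]; rewrite ?set21.
  have xyE : [set x; y] \in edges G by apply/edgesP; exists x, y.
  have /domD/exists_inP[f fD /andP[_ /set0Pn[z]]] :
    [set x; y] \in edges G :\: D by rewrite inE xyD.
  rewrite !inE => /andP[/orP[]/eqP-> zf]; apply/orP; [left|right];
    by apply/bigcupP; exists f.
move=> cov e /setDP[/edgesP[x [y [xy ->]]] xyD].
have [z zxy /bigcupP[f fD zf]] : exists2 z, z \in [set x; y] & z \in cover D.
  by case/orP: (cov x y xy) => ?; [exists x | exists y]; rewrite ?set21 ?set22.
apply/exists_inP; exists f => //; apply/andP; split.
  by apply: contraNneq xyD => ->.
by apply/set0Pn; exists z; rewrite inE zxy.
Qed.

(** Two distinct uncovered vertices would span an edge that is not dominated. *)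
Lemma complete_dominating D : complete G -> D \subset edges G ->
  edge_dominating D = (#|~: cover D| <= 1).
Proof.
move=> Gc DE; apply/(edge_dominatingP DE)/card_le1_eqP.
  move=> cov x y; rewrite !inE => xD yD; apply/eqP; apply: contraR xD => xy.
  by have := cov x y; rewrite Gc eq_sym xy (negPf yD) orbF; apply.
move=> unc x y; rewrite Gc; apply: contraR; rewrite negb_or => /andP[xD yD].
by apply/eqP/unc; rewrite inE.
Qed.

(** Two edges have at most four endpoints, and at most one vertex is not an
    endpoint of an edge of [D]. *)
Lemma complete_dominating_order D : complete G ->
  edge_dominating D -> #|D| <= 2 -> #|G| <= 5.
Proof.
move=> Gc domD D2; have DE : D \subset edges G by case/andP: domD.
move: domD; rewrite complete_dominating // => unc.
rewrite -(cardsC (cover D)) -[5]/(4 + 1); apply: leq_add unc.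
apply: leq_trans (leq_card_cover D) _.
rewrite (eq_bigr (fun=> 2)) => [|e eD]; last exact/card_edge/(subsetP DE).
by rewrite sum_nat_const -[4]/(2 * 2) leq_mul2r.
Qed.

End Edges.

Section Partitions.
Variable T : finType.
Implicit Types (P : {set {set T}}) (E : {set T}).

Lemma partition_block_gt0 P E A : partition P E -> A \in P -> 0 < #|A|.
Proof.
case/and3P=> _ _ P0 AP; rewrite card_gt0.
by apply: contraNneq P0 => <-.
Qed.

Lemma card_partition_le P E : partition P E -> #|P| <= #|E|.
Proof.
move=> partP; rewrite (card_partition partP) -sum1_card.
by apply: leq_sum => A; apply: (partition_block_gt0 partP).
Qed.

(** [#|E|] is the sum of the block sizes, each at least 1, so equality with the
    number of blocks forces every size to be 1. *)
Lemma partition_card_singletons P E : partition P E -> #|P| = #|E| ->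
  {in P, forall A : {set T}, #|A| = 1}.
Proof.
move=> partP; rewrite (card_partition partP) -sum1_card => eq_card A AP.
have le1 B : B \in P -> 1 <= #|B| ?= iff (#|B| == 1).
  by move=> /(partition_block_gt0 partP) B0; rewrite eq_sym; apply: leqif_eq.
have [_] := leqif_sum le1.
by rewrite eq_card eqxx => /esym/forall_inP/(_ A AP)/eqP.
Qed.

Lemma partition_singletons E : partition [set [set x] | x in E] E.
Proof.
apply/and3P; split.
- apply/eqP/setP=> x; apply/bigcupP/idP => [[A /imsetP[y yE ->]]|xE].
    by move/set1P->.
  by exists [set x]; rewrite ?set11 // imset_f.
- apply/trivIsetP=> A B /imsetP[x _ ->] /imsetP[y _ ->] xy.
  by rewrite disjoints1 inE; apply: contraNneq xy => ->.
- by apply/imsetP=> -[x _ /setP/(_ x)]; rewrite !inE eqxx.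
Qed.

End Partitions.

Section ECNumber.
Variable G : sgraph.

Lemma EC_le_card_edges : EC G <= #|edges G|.
Proof. by apply/bigmax_leqP=> P /andP[/card_partition_le]. Qed.

Lemma EC_attained : 0 < EC G -> exists2 P, @ec_partition G P & #|P| = EC G.
Proof.
move=> EC0; have [P ecP] : exists P, @ec_partition G P.
  apply/existsP; apply: contraLR EC0; rewrite negb_exists -leqNgt => /forallP no.
  by apply/bigmax_leqP=> P ecP; have := no P; rewrite ecP.
have ec_gt0 : 0 < #|@ec_partition G| by apply/card_gt0P; exists P.
by have [Q ecQ eqQ] := eq_bigmax_cond (fun P : {set {set {set G}}} => #|P|) ec_gt0; exists Q.
Qed.

(** The set is a block that dominates by itself, or the union of a block with
    its coalition partner. *)
Lemma singletons_small_dominating P : @ec_partition G P ->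
  {in P, forall A : {set {set G}}, #|A| = 1} -> P != set0 ->
  exists2 D : {set {set G}}, edge_dominating D & #|D| <= 2.
Proof.
case/andP=> _ /forall_inP ecP P1 /set0Pn[A AP].
case/orP: (ecP A AP) => [/andP[_ domA]|/andP[_ /exists_inP[B]]].
  by exists A; rewrite ?P1.
case/setD1P=> _ BP; case/and5P=> _ _ _ _ /andP[_ domAB].
exists (A :|: B) => //; rewrite cardsU.
by apply: leq_trans (leq_subr _ _) _; rewrite !P1.
Qed.

Lemma EC_max_complete : 2 <= #|G| -> EC G = 'C(#|G|, 2) ->
  complete G /\ #|G| <= 5.
Proof.
move=> G2 ecG; have EC0 : 0 < EC G by rewrite ecG bin_gt0.
have Gc : complete G.
  by apply: complete_of_card_edges; rewrite -ecG EC_le_card_edges.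
split=> //; have [P ecP cardP] := EC_attained EC0.
have partP : partition P (edges G) by case/andP: ecP.
have P1 : {in P, forall A : {set {set G}}, #|A| = 1}.
  apply: partition_card_singletons partP _.
  by rewrite cardP ecG card_edges_complete.
have [|D domD D2] := singletons_small_dominating ecP P1.
  by rewrite -card_gt0 cardP.
exact: complete_dominating_order Gc domD D2.
Qed.

(** The order decides between the two kinds of blocks: an edge misses
    [#|G| - 2] vertices, so the singletons dominate when [#|G| <= 3], and
    otherwise each has any disjoint edge as a partner. *)
Lemma complete_singletons_ec_partition : complete G -> 2 <= #|G| <= 5 ->
  @ec_partition G [set [set e] | e in edges G].
Proof.
move=> Gc /andP[G2 G5]; rewrite /ec_partition partition_singletons /=.
apply/forall_inP=> _ /imsetP[e eE ->]; rewrite cards1 /=.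
have sub1 f : f \in edges G -> [set f] \subset edges G by rewrite sub1set.
have card_unc f : f \in edges G -> #|~: f| = #|G| - 2.
  by move=> fE; rewrite cardsCs setCK (card_edge fE).
have dom1 f : f \in edges G -> edge_dominating [set f] = (#|G| - 2 <= 1).
  by move=> fE; rewrite complete_dominating ?sub1 // /cover big_set1 card_unc.
rewrite dom1 //; case: leqP => //= unc2.
(* Two vertices missed by [e] span the partner edge. *)
have /card_gt1P[x [y [xe ye xy]]] : 1 < #|~: e| by rewrite card_unc.
set f := [set x; y].
have f_sub : f \subset ~: e by rewrite subUset !sub1set xe ye.
have ef0 : [disjoint e & f] by rewrite disjoint_sym disjoints_subset.
have fE : f \in edges G by apply/edgesP; exists x, y; rewrite Gc.
have fe : f != e.
  by apply: contraTneq xe => <-; rewrite inE /f set21.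
apply/exists_inP; exists [set f].
  by rewrite !inE imset_f // andbT (inj_eq set1_inj).
rewrite /edge_coalition !sub1 // !dom1 // -!ltnNge !unc2 /=.
rewrite disjoints1 inE eq_sym fe /=.
rewrite complete_dominating //; last by rewrite subUset !sub1.
have -> : cover ([set e] :|: [set f]) = e :|: f.
  by rewrite /cover bigcup_setU !big_set1.
rewrite cardsCs setCK cardsU disjoint_setI0 // cards0 subn0.
by rewrite (card_edge eE) (card_edge fE) leq_subLR.
Qed.

Lemma complete_EC_max : complete G -> 2 <= #|G| <= 5 ->
  EC G = 'C(#|G|, 2).
Proof.
move=> Gc G25; rewrite -card_edges_complete //; apply/eqP.
rewrite eqn_leq EC_le_card_edges -(card_imset _ (@set1_inj _)) /=.
apply: (leq_bigmax_cond (F := fun P : {set {set {set G}}} => #|P|)).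
exact: complete_singletons_ec_partition.
Qed.

End ECNumber.

Theorem proposition4p6 (G : sgraph) (n : nat) (hn : #|G| = n) (hn2 : 2 <= n)
    (hG : connected_graph G) :
  EC G = (n * (n - 1)) %/ 2 <->
  [\/ isomorphic G (complete_graph 2), isomorphic G (complete_graph 3),
      isomorphic G (complete_graph 4) | isomorphic G (complete_graph 5)].
Proof.
rewrite divn2 subn1 -bin2; subst n; split=> [ecG|isoG].
  have [Gc G5] := EC_max_complete hn2 ecG.
  have iso k : #|G| = k -> isomorphic G (complete_graph k).
    by move=> cardG; apply/isomorphic_completeP.
  move: hn2 G5 iso; case: #|G| => [|[|[|[|[|[|k]]]]]] // _ _ iso.
  - by constructor 1; apply: iso.
  - by constructor 2; apply: iso.
  - by constructor 3; apply: iso.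
  - by constructor 4; apply: iso.
by case: isoG => /isomorphic_completeP[Gc cardG];
  apply: complete_EC_max => //; rewrite cardG.
Qed.
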